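(* Let $a,b\in\mathbb{C}_p$, $a\neq b$. Suppose $f(x) = \sum_{n \geq 0}c_{n}(x - b)^{n} \in H(\mathcal{A}(a,b))$ and $f$ is bounded (in which case put $\beta=0$) or has controlled coefficients of order $\beta$ with $0\le\beta < 1$. Let $\varphi$ be a path sequence satisfying $$\varphi(k) - (\beta + 1)\nabla \varphi(k) - \beta \log_{p} \varphi(k) \to \infty \quad \text{as } k \to \infty .$$ Let $\theta$ be an auxiliary function satisfying $$\varphi(k) - \beta\varphi(k + 1) - \beta \log_{p} \varphi(k) -\theta(k) \to \infty \quad \text{as } k \to \infty.$$ Furthermore suppose that, given any $\varepsilon > 0$, there is a $K_{\varepsilon}$ such that for $k > K_{\varepsilon}$ and all $d \in \mathbb{Z}^{+}$ we have $$\left| c_{dp^{\theta(k) + \nabla\varphi(k)} - 1}\left(a - b\right)^{dp^{\theta(k) + \nabla\varphi(k)}} - c_{dp^{\theta(k)} - 1}\left(a - b\right)^{dp^{\theta(k)}}\right|_{p} < \varepsilon .$$ Then $\int_{\mathcal{A}(a,b),\varphi}f(x)\,dx$ exists.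
   Context: $p$ is an odd prime; $\mathbb{C}_p$ is the completion of an algebraic closure of $\mathbb{Q}_p$, with $|p|_p=1/p$. For real positive $x$, $\log_p x$ is the real logarithm to base $p$. Arc: for $a\ne b$ in $\mathbb{C}_p$ with $R=|a-b|_p$, the arc $\mathcal{A}(a,b)$ is the open disc $\{x : |x-b|_p<R\}$. $H(\mathcal{A})$ is the set of functions on $\mathcal{A}$ given by a single power series convergent on $\mathcal{A}$. $f=\sum_{n\ge0} c_n(x-b)^n\in H(\mathcal{A}(a,b))$ has controlled coefficients of order $\beta\ge0$ if there are real constants $M$ and $n_0>0$ with $|c_n|_pR^n<Mn^\beta$ for all $n>n_0$. Path sequence: a function $\varphi$ defined for all integers $k\ge k_0$ (some $k_0\in\mathbb{Z}^+$), with values in $\mathbb{Z}^+$ and strictly increasing; $\nabla\varphi(k)=\varphi(k+1)-\varphi(k)$. Auxiliary function: a function $\theta$ defined for all integers $k\ge k_0$ (some $k_0\in\mathbb{Z}^+$), with values in $\mathbb{Z}^+$ and $\lim_{k\to\infty}\theta(k)=\infty$. For $f:\mathcal{A}(a,b)\to\mathbb{C}_p$ put $A_{f,\varphi}(k)=p^{-\varphi(k)}\sum_{\zeta}(x-a)f(x)$, where $x=a+(b-a)\zeta$ and $\zeta$ runs through the $p^{\varphi(k)}$-th roots of unity; $\int_{\mathcal{A}(a,b),\varphi}f(x)\,dx=\lim_{k\to\infty}A_{f,\varphi}(k)$ if the limit exists. *)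

(* Defs.v *)
(* Mathematical Components with MathComp-Analysis. *)
From HB Require Import structures.
From mathcomp Require Import all_boot all_order all_algebra.
From mathcomp Require Import all_classical all_reals all_analysis.

Set Implicit Arguments.
Unset Strict Implicit.
Unset Printing Implicit Defensive.

Import Order.TTheory GRing.Theory Num.Theory.
Import numFieldNormedType.Exports.

Local Open Scope classical_set_scope.
Local Open Scope ring_scope.

Section ValuedFields.
Variable R : realType.

Record is_absval (K : fieldType) (v : K -> R) : Prop := IsAbsval {
  absval_ge0 : forall x, 0 <= v x;
  absval_eq0 : forall x, v x = 0 <-> x = 0;
  absvalM : forall x y, v (x * y) = v x * v y;
  absvalD_max : forall x y, v (x + y) <= Num.max (v x) (v y)
}.

(* A field with a p-adic absolute value is not a normedZmodType
   (`|x *+ n| = `|x| *+ n fails), so limits go through the distances in R. *)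
Definition v_cvg (K : fieldType) (v : K -> R) (u : nat -> K) (l : K) : Prop :=
  (fun n => v (u n - l)) @ \oo --> (0 : R).

Definition v_cauchy (K : fieldType) (v : K -> R) (u : nat -> K) : Prop :=
  forall e : R, 0 < e ->
    exists N : nat, forall m n, (N <= m)%N -> (N <= n)%N -> v (u m - u n) < e.

Record is_completion (F K : fieldType) (vF : F -> R) (vK : K -> R)
    (i : {rmorphism F -> K}) : Prop := IsCompletion {
  completion_isom : forall x, vK (i x) = vF x;
  completion_dense : forall (y : K) (e : R), 0 < e ->
    exists x : F, vK (y - i x) < e;
  completion_complete : forall u : nat -> K, v_cauchy vK u ->
    exists l : K, v_cvg vK u l
}.

Definition padic_absq (p : nat) (x : rat) : R :=
  if x == 0 then 0
  else p%:R ^ ((logn p `|denq x|)%:Z - (logn p `|numq x|)%:Z).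

(* C_p with its construction: Q_p completes (rat, |.|_p), Q_p^alg is an
   algebraic closure of Q_p with an extension of |.|_p, and C_p completes
   Q_p^alg.  These data are unique up to isometric isomorphism. *)
Record padicComplex (p : nat) := PadicComplex {
  pc_Qp : fieldType;
  pc_Qp_abs : pc_Qp -> R;
  pc_Qp_absP : is_absval pc_Qp_abs;
  pc_Q_Qp : {rmorphism rat -> pc_Qp};
  pc_Qp_completion : is_completion (padic_absq p) pc_Qp_abs pc_Q_Qp;

  pc_Qpalg : closedFieldType;
  pc_Qpalg_abs : pc_Qpalg -> R;
  pc_Qpalg_absP : is_absval pc_Qpalg_abs;
  pc_Qp_Qpalg : {rmorphism pc_Qp -> pc_Qpalg};
  pc_Qp_Qpalg_isom : forall x, pc_Qpalg_abs (pc_Qp_Qpalg x) = pc_Qp_abs x;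
  pc_Qpalg_algebraic : forall x : pc_Qpalg, algebraicOver pc_Qp_Qpalg x;

  pc_Cp :> fieldType;
  pc_abs : pc_Cp -> R;
  pc_absP : is_absval pc_abs;
  pc_Qpalg_Cp : {rmorphism pc_Qpalg -> pc_Cp};
  pc_Cp_completion : is_completion pc_Qpalg_abs pc_abs pc_Qpalg_Cp
}.

End ValuedFields.

Section ArcIntegral.
Variables (R : realType) (p : nat) (Cp : padicComplex R p).

Definition padic_arc (a b : Cp) : set Cp :=
  [set x | pc_abs (x - b) < pc_abs (a - b)].

(* H(padic_arc a b) is the set of the f for which such a c exists; the values of f
   outside the arc are irrelevant. *)
Definition expansion_on_arc (a b : Cp) (f : Cp -> Cp) (c : nat -> Cp) : Prop :=
  forall x, padic_arc a b x ->
    v_cvg (@pc_abs _ _ Cp) (fun N => \sum_(0 <= n < N) c n * (x - b) ^+ n) (f x).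

Definition bounded_on_arc (a b : Cp) (f : Cp -> Cp) : Prop :=
  exists M : R, forall x, padic_arc a b x -> pc_abs (f x) <= M.

Definition controlled_coefficients (a b : Cp) (c : nat -> Cp) (beta : R) : Prop :=
  exists M n0 : R, 0 < n0 /\
    forall n : nat, n0 < n%:R ->
      pc_abs (c n) * pc_abs (a - b) ^+ n < M * n%:R `^ beta.

(* The sum has finite support, hence is a genuine sum over all the roots. *)
Definition arc_sum (a b : Cp) (f : Cp -> Cp) (phi : nat -> nat) (k : nat) : Cp :=
  (p%:R ^+ phi k)^-1 *
  \sum_(zeta \in [set z : Cp | z ^+ (p ^ phi k) = 1])
     (let x := a + (b - a) * zeta in (x - a) * f x).

Definition is_arc_integral (a b : Cp) (f : Cp -> Cp) (phi : nat -> nat)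
    (l : Cp) : Prop :=
  v_cvg (@pc_abs _ _ Cp) (arc_sum a b f phi) l.

Definition arc_integrable (a b : Cp) (f : Cp -> Cp) (phi : nat -> nat) : Prop :=
  exists l : Cp, is_arc_integral a b f phi l.

End ArcIntegral.

(* Path sequences and auxiliary functions are total on nat, with arbitrary
   values below k0. *)
Definition path_sequence (phi : nat -> nat) : Prop :=
  exists k0 : nat, (0 < k0)%N /\
    forall k, (k0 <= k)%N -> (0 < phi k)%N /\ (phi k < phi k.+1)%N.

(* The truncated subtraction is exact from k0 on. *)
Definition nabla (phi : nat -> nat) (k : nat) : nat := (phi k.+1 - phi k)%N.

Definition auxiliary_function (theta : nat -> nat) : Prop :=
  (exists k0 : nat, (0 < k0)%N /\ forall k, (k0 <= k)%N -> (0 < theta k)%N)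
  /\ theta @ \oo --> \oo.

Definition logb (R : realType) (p : nat) (x : R) : R := ln x / ln (p%:R : R).

(* Main.v *)
Require Import Defs.
From HB Require Import structures.
From mathcomp Require Import all_boot all_order all_algebra.
From mathcomp Require Import cyclic separable cyclotomic.
From mathcomp Require Import zify ring lra.
From mathcomp Require Import all_classical all_reals all_analysis.

Set Implicit Arguments.
Unset Strict Implicit.
Unset Printing Implicit Defensive.

Import Order.TTheory GRing.Theory Num.Theory.
Import numFieldNormedType.Exports.

Local Open Scope classical_set_scope.
Local Open Scope ring_scope.

(** Put [w N = c_(N-1) (a-b)^N], [q = p^(phi k)].  Expanding [f] at
    [x = a + (b-a) z] and summing over the [q]-th roots of unity [z] gives
    [A(k) = - sum_N w N * S_q(N)], where [S_q(N)] is the sum of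
    [(-1)^j C(N-1, j)] over [j = -1 mod q].  These sums obey
    - [|S_q(N)| <= p^(t - phi k)] when [p^t] does not divide [N], because
      [N C(N-1, m-1) = m C(N, m)];
    - [|S_q(N)| <= q p^(- floor ((N-1)/q))], because [|1-z|^q <= 1/p];
    - [|S_(q p^D)(N p^D) - S_q(N)| <= 1/q], because
      [C(p n - 1, p m - 1) = C(n - 1, m - 1)] modulo [m].
    With [|w N| <= M N^beta], the second bound disposes of the [N] much larger
    than [phi k * q], and the first of the other [N] not divisible by
    [p^(theta k)] (resp. [p^(theta k + nabla phi k)] in [A(k+1)]).  The
    remaining terms of [A(k)] and [A(k+1)] are compared one to one by the third
    bound and the hypothesis on the coefficients, so [A(k+1) - A(k)] tends to
    [0]; by the ultrametric inequality [A] is a Cauchy sequence. *)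

(** * Congruences for binomial coefficients modulo powers of [p] *)

(** The difference of the powers is [x - y] times the sum of the [x ^+ (p.-1 - i) * y ^+ i]. As
    [0 < e], [x] and [y] agree modulo [p], so this sum is [p] times [y ^+ p.-1] modulo [p], which
    supplies one more factor [p]. *)
Lemma expr_modn (A : comPzRingType) (p e : nat) (x y g : A) : (0 < e)%N ->
  x = y + g *+ p ^ e -> exists h : A, x ^+ p = y ^+ p + h *+ p ^ e.+1.
Proof.
case: e => // e _ xy.
have xym m : x ^+ m = y ^+ m
    + (g *+ p ^ e * \sum_(i < m) x ^+ (m.-1 - i) * y ^+ i) *+ p.
  apply/eqP; rewrite addrC -subr_eq subrXX {1}xy addrAC subrr add0r.
  by rewrite expnSr mulrnA mulrnAl.
set t := fun m => g *+ p ^ e * \sum_(i < m) x ^+ (m.-1 - i) * y ^+ i in xym.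
exists (g * (y ^+ p.-1 + \sum_(i < p) t (p.-1 - i)%N * y ^+ i)).
apply/eqP; rewrite addrC -subr_eq subrXX {1}xy addrAC subrr add0r.
rewrite [in X in _ == X]expnSr mulrnA mulrnAl mulrnAC; apply/eqP.
congr (_ *+ _); rewrite -mulrnAr; congr (_ * _).
rewrite mulrnDl -[in RHS]sumrMnl -[X in y ^+ _ *+ X](card_ord p) -sumr_const.
rewrite -big_split /=; apply: eq_bigr => i _.
rewrite {1}xym mulrDl -exprD subnK; last by have := ltn_ord i; case: (p) i.
by rewrite mulrnAl.
Qed.

Lemma exprD1X_modp (p : nat) : prime p ->
  exists g : {poly int}, (1 + 'X) ^+ p = 1 + 'X^p + g *+ p.
Proof.
move=> pp; exists (\sum_(i < p.-1) 'X^(i.+1) *+ ('C(p, i.+1) %/ p)).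
have p0 := prime_gt0 pp.
rewrite exprDn big_ord_recl expr1n expr0 mulr1 bin0 mulr1n -addrA; congr (_ + _).
rewrite -(prednK p0) big_ord_recr /= expr1n mul1r /bump /= add1n prednK // binn.
rewrite mulr1n addrC -sumrMnl; congr (_ + _); apply: eq_bigr => i _.
rewrite expr1n mul1r -mulrnA divnK //; apply: prime_dvd_bin => //.
by have := ltn_ord i; lia.
Qed.

(** The two binomials are the coefficients of degree [p * m] in [(1 + 'X) ^+ (p * n)] and in
    [(1 + 'X^p) ^+ n]. With [e = logn p n] these polynomials agree modulo [p ^ e.+1]: each factor
    [p] of [n] improves the congruence [exprD1X_modp] by one power of [p]. *)
Lemma bin_mul_prime (p n m : nat) : prime p ->
  exists z : int,
    'C(p * n, p * m)%:R = 'C(n, m)%:R + z * (p ^ (logn p n).+1)%:R :> int.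
Proof.
move=> pp; have [->|n0] := posnP n.
  case: m => [|m]; first by exists 0; rewrite muln0 !bin0 mul0r addr0.
  exists 0; rewrite muln0 !bin_small ?mul0r ?addr0 // muln_gt0 prime_gt0 //.
have coefD1X k i : ((1 + 'X : {poly int}) ^+ k)`_i = 'C(k, i)%:R.
  rewrite exprDn coef_sum (eq_bigr (fun j : 'I_k.+1 =>
    if i == j then 'C(k, i)%:R else 0)); last first.
    move=> j _; rewrite expr1n mul1r coefMn coefXn.
    by case: eqP => [->|]; rewrite ?mul0rn.
  rewrite -big_mkcond /=; have [ik|ik] := ltnP i k.+1.
    by rewrite (big_pred1 (Ordinal ik)) // => j; rewrite eq_sym.
  rewrite big_pred0 ?bin_small // => j; apply/negbTE.
  by apply: contraTneq (ltn_ord j) => <-; rewrite -leqNgt.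
have iter e : exists g : {poly int},
    ((1 + 'X) ^+ p) ^+ (p ^ e) = (1 + 'X^p) ^+ (p ^ e) + g *+ p ^ e.+1.
  elim: e => [|e [g IH]].
    by rewrite !expn0 !expr1 expn1; apply: exprD1X_modp.
  have [h Hh] := expr_modn (ltn0Sn e) IH.
  by exists h; rewrite expnSr !(exprM _ (p ^ e)%N).
have [g Hg] := iter (logn p n).
set e := logn p n in Hg *.
pose u := (n %/ p ^ e)%N.
have nE : n = (p ^ e * u)%N by rewrite mulnC divnK // pfactor_dvdnn.
(* The remaining exponent [u] loses nothing, as a difference of [u]-th powers is a multiple of the
   difference of the bases. *)
have [h Hh] : exists h : {poly int},
    (1 + 'X) ^+ (p * n) = (1 + 'X^p) ^+ n + h *+ p ^ e.+1.
  exists (g * \sum_(i < u) ((1 + 'X^p) ^+ (p ^ e) + g *+ p ^ e.+1) ^+ (u.-1 - i)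
    * ((1 + 'X^p) ^+ (p ^ e)) ^+ i).
  rewrite {1 2}nE mulnA !exprM Hg; apply/eqP.
  by rewrite [X in _ == X]addrC -subr_eq subrXX addrAC subrr add0r mulrnAl.
exists (h`_(p * m)).
rewrite mulr_natr -coefD1X Hh coefD coefMn; congr (_ + _).
have -> : (1 + 'X^p) ^+ n = ((1 + 'X) ^+ n) \Po 'X^p :> {poly int}.
  by rewrite rmorphXn rmorphD rmorph1 /= comp_polyX.
rewrite coef_comp_poly_Xn ?prime_gt0 // dvdn_mulr // mulKn ?prime_gt0 //.
Qed.

(** * Elementary properties of ultrametric absolute values *)

Section AbsoluteValue.
Variables (R : realType) (K : fieldType) (v : K -> R) (hv : is_absval v).

Lemma absval0 : v 0 = 0. Proof. by apply/(absval_eq0 hv). Qed.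

Lemma absval_gt0 x : x != 0 -> 0 < v x.
Proof.
move=> x0; rewrite lt_neqAle absval_ge0 // andbT eq_sym.
by apply: contraNneq x0 => /(absval_eq0 hv) ->.
Qed.

Lemma absval1 : v 1 = 1.
Proof.
have v1 := absval_gt0 (oner_neq0 K).
by apply: (mulfI (lt0r_neq0 v1)); rewrite -absvalM // !mulr1.
Qed.

Lemma absvalX x n : v (x ^+ n) = v x ^+ n.
Proof. by elim: n => [|n IH]; rewrite ?absval1 // !exprS absvalM // IH. Qed.

Lemma absval_unity x n : (0 < n)%N -> x ^+ n = 1 -> v x = 1.
Proof.
move=> n0 xn; apply/eqP; rewrite -(@pexpr_eq1 _ _ n) ?absval_ge0 //.
by rewrite -absvalX xn absval1.
Qed.

Lemma absvalN x : v (- x) = v x.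
Proof.
rewrite -mulN1r absvalM // (@absval_unity (-1) 2) ?mul1r //.
by rewrite sqrrN expr1n.
Qed.

Lemma absvalV x : v x^-1 = (v x)^-1.
Proof.
have [->|x0] := eqVneq x 0; first by rewrite invr0 absval0 invr0.
apply: (mulfI (lt0r_neq0 (absval_gt0 x0))).
by rewrite -absvalM // mulfV // absval1 mulfV // lt0r_neq0 // absval_gt0.
Qed.

Lemma absval_distC x y : v (x - y) = v (y - x).
Proof. by rewrite -absvalN opprB. Qed.

Lemma absvalD_le e x y : v x <= e -> v y <= e -> v (x + y) <= e.
Proof. by move=> xe ye; apply: (le_trans (absvalD_max hv _ _)); rewrite ge_max xe. Qed.

Lemma absvalB_le e x y : v x <= e -> v y <= e -> v (x - y) <= e.
Proof. by move=> xe ye; apply: absvalD_le; rewrite ?absvalN. Qed.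

Lemma absval_sum_le (I : Type) (r : seq I) (P : pred I) (F : I -> K) e :
  0 <= e -> (forall i, P i -> v (F i) <= e) -> v (\sum_(i <- r | P i) F i) <= e.
Proof.
move=> e0 Fe; apply: (big_ind (fun x => v x <= e)) => //.
  by rewrite absval0.
exact: absvalD_le.
Qed.

Lemma absval_natr_le1 n : v n%:R <= 1.
Proof.
elim: n => [|n IH]; first by rewrite absval0.
by rewrite -natr1; apply: absvalD_le; rewrite ?absval1.
Qed.

Lemma absval_intr_le1 (z : int) : v z%:~R <= 1.
Proof.
by case: z => n; rewrite ?NegzE ?mulrNz ?absvalN; apply: absval_natr_le1.
Qed.

End AbsoluteValue.

(** * Sums over roots of unity and alternating binomial sums *)

(** In each block of [q] consecutive indices only the last one qualifies. *)
Lemma sum_multiples (A : nmodType) (F : nat -> A) q l : (0 < q)%N ->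
  \sum_(0 <= j < l * q | (q %| j.+1)%N) F j = \sum_(0 <= d < l) F (d.+1 * q).-1.
Proof.
move=> q0; rewrite big_mkcond big_nat_mul /=; apply: eq_bigr => d _.
have dq : (d.+1 * q = (d.+1 * q).-1.+1)%N by rewrite prednK // muln_gt0.
rewrite dq big_nat_recr /=; last by rewrite -ltnS -dq ltn_pmul2r.
rewrite -dq dvdn_mull // big_nat_cond big1 ?add0r // => j.
rewrite andbT => /andP[j1 j2]; case: ifP => // /dvdnP[e je].
have : (d * q < e * q)%N by rewrite -je ltnS.
have : (e * q < d.+1 * q)%N by rewrite -je dq ltnS.
by rewrite !ltn_pmul2r // ltnS leqNgt => /negP.
Qed.

Lemma sum_prim_root_expr (K : fieldType) (q : nat) (z : K) j :
  q.-primitive_root z ->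
  \sum_(i < q) z ^+ (i * j) = if (q %| j)%N then q%:R else 0.
Proof.
move=> zq; rewrite (prim_order_dvd zq).
under eq_bigr => i _ do rewrite mulnC exprM.
case: ifPn => [/eqP->|zj].
  under eq_bigr do rewrite expr1n.
  by rewrite sumr_const card_ord.
apply: (mulfI (x := z ^+ j - 1)); first by rewrite subr_eq0.
by rewrite -subrX1 exprAC (prim_expr_order zq) expr1n subrr mulr0.
Qed.

(* Indexed by [n = N - 1]; the terms with [(d + 1) q - 1 > n] vanish. *)
Definition fleck_sum (K : fieldType) (q n : nat) : K :=
  \sum_(0 <= d < n.+1)
     (-1) ^+ (d.+1 * q).-1 * 'C(n, (d.+1 * q).-1)%:R.

Lemma fleck_sum_widen (K : fieldType) (q n m : nat) : (0 < q)%N -> (n < m)%N ->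
  fleck_sum K q n =
  \sum_(0 <= d < m) (-1) ^+ (d.+1 * q).-1 * 'C(n, (d.+1 * q).-1)%:R.
Proof.
move=> q0 nm; rewrite [RHS](big_cat_nat (n := n.+1)) //=.
rewrite [X in _ + X]big_nat_cond [X in _ + X]big1 ?addr0 // => d.
rewrite andbT => /andP[nd _]; rewrite bin_small ?mulr0 //.
by rewrite -ltnS prednK ?muln_gt0 // (leq_trans (n := d.+1)) ?ltnS // leq_pmulr.
Qed.

(** Binomial expansion, then orthogonality of the powers of [z], which keeps the [j] with [q]
    dividing [j.+1]. *)
Lemma fleck_sumE (K : fieldType) (q n : nat) (z : K) :
  q.-primitive_root z -> q%:R != 0 :> K ->
  q%:R^-1 * \sum_(i < q) z ^+ i * (1 - z ^+ i) ^+ n = fleck_sum K q n.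
Proof.
move=> zq qn0; have q0 := prim_order_gt0 zq.
pose G j : K := (-1) ^+ j * 'C(n, j)%:R.
have -> : \sum_(i < q) z ^+ i * (1 - z ^+ i) ^+ n
    = \sum_(j < n.+1) G j * \sum_(i < q) z ^+ (i * j.+1).
  under [RHS]eq_bigr do rewrite mulr_sumr.
  rewrite exchange_big; apply: eq_bigr => i _ /=.
  rewrite exprBn mulr_sumr; apply: eq_bigr => j _.
  rewrite expr1n mulr1 -mulr_natr mulnS exprD exprM /G; ring.
have -> : fleck_sum K q n = \sum_(0 <= j < n.+1 * q | (q %| j.+1)%N) G j.
  by rewrite sum_multiples.
(* The range consists of whole blocks of length [q]; its indices beyond [n] have vanishing
   binomials. *)
have -> : \sum_(0 <= j < n.+1 * q | (q %| j.+1)%N) G j =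
          \sum_(0 <= j < n.+1 | (q %| j.+1)%N) G j.
  have nq : (n.+1 <= n.+1 * q)%N by rewrite leq_pmulr.
  rewrite (big_cat_nat (n := n.+1)) //= [X in _ + X]big_nat_cond.
  rewrite [X in _ + X]big1 ?addr0 // => j /andP[/andP[nj _] _].
  by rewrite /G bin_small // mulr0.
rewrite big_mkord mulr_sumr [RHS]big_mkcond; apply: eq_bigr => j _.
by rewrite (sum_prim_root_expr _ zq); case: ifP; rewrite ?mulr0 // mulrCA mulVf ?mulr1.
Qed.

(** * Estimates for binomials, roots of unity and [fleck_sum] *)

Definition extends_padic (R : realType) (p : nat) (K : fieldType) (v : K -> R) :=
  forall n, (0 < n)%N -> v n%:R = p%:R ^- logn p n.

Section Padic.
Variables (R : realType) (p : nat) (p_prime : prime p) (p_odd : odd p).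
Variables (K : fieldType) (v : K -> R) (hv : is_absval v).
Hypothesis vp : extends_padic p v.

Let p1 : (1 <= p%:R :> R). Proof. by rewrite ler1n prime_gt0. Qed.
Let p0 : (0 < p%:R :> R). Proof. by rewrite ltr0n prime_gt0. Qed.
Let pn0 n : (p%:R ^+ n != 0 :> R). Proof. by rewrite lt0r_neq0 // exprn_gt0. Qed.

Lemma natr_neq0 n : (0 < n)%N -> n%:R != 0 :> K.
Proof.
move=> n0; apply/eqP => n0'; have := vp n0; rewrite n0' absval0 //.
by move/esym/eqP; rewrite invr_eq0 (negbTE (pn0 _)).
Qed.

Lemma absval_expp s : v (p ^ s)%:R = p%:R ^- s.
Proof. by rewrite vp ?expn_gt0 ?prime_gt0 // pfactorK. Qed.

Lemma absval_dvd_le s n : (p ^ s %| n)%N -> v n%:R <= p%:R ^- s.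
Proof.
move=> /dvdnP[m ->]; rewrite natrM absvalM // absval_expp.
by rewrite ler_piMl ?absval_natr_le1 // invr_ge0 exprn_ge0 // ltW.
Qed.

Lemma absval_ndvd_ge t n : ~~ (p ^ t %| n)%N -> p%:R ^- t.-1 <= v n%:R.
Proof.
case: n => [|n]; first by rewrite dvdn0.
rewrite pfactor_dvdn // -ltnNge vp // => nt.
by rewrite lef_pV2 ?posrE ?exprn_gt0 // ler_weXn2l // -ltnS (ltn_predK nt).
Qed.

(** The equation gives [v a = v m * v b / v n] with [v b <= 1]. It is applied to the identity
    [mul_bin_diag]. *)
Lemma absval_dvd_ndvd_le t s n m a b : ~~ (p ^ t %| n)%N -> (p ^ s %| m)%N ->
  (n * a = m * b)%N -> v a%:R <= p%:R ^+ t.-1 / p%:R ^+ s.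
Proof.
move=> tn sm /(congr1 (fun k : nat => v k%:R)); rewrite !natrM !absvalM // => E.
rewrite -[leLHS](mulVKf (pn0 t.-1)).
rewrite ler_wpM2l ?exprn_ge0 ?(ltW p0) //.
apply: le_trans (_ : v n%:R * v a%:R <= _).
  by rewrite ler_wpM2r ?absval_ge0 // absval_ndvd_ge.
rewrite E -[leRHS]mulr1.
by rewrite ler_pM ?absval_ge0 ?absval_dvd_le ?absval_natr_le1.
Qed.

(** Both binomials equal [m / n] times the ones with undecremented arguments, since [p] cancels in
    the first ratio. The difference of the latter is divisible by [p ^ (logn p n).+1], which
    outweighs the denominator [n]. *)
Lemma absval_bin_pred_mul n m : (0 < n)%N -> (0 < m)%N ->
  v ('C((p * n).-1, (p * m).-1)%:R - 'C(n.-1, m.-1)%:R) <= v m%:R.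
Proof.
move=> n0 m0.
have binE k l : (0 < k)%N -> (0 < l)%N ->
    'C(k.-1, l.-1)%:R = l%:R / k%:R * 'C(k, l)%:R :> K.
  move=> k0 l0; apply: (mulfI (natr_neq0 k0)).
  rewrite -natrM mul_bin_diag prednK // natrM mulrA; congr (_ * _).
  by rewrite mulrCA mulfV ?mulr1 // natr_neq0.
have [z /(congr1 (intr : int -> K))] := bin_mul_prime n m p_prime.
rewrite rmorphD rmorphM /= !rmorph_nat => pnm.
have pp0 := prime_gt0 p_prime.
rewrite !binE ?muln_gt0 ?pp0 // !natrM invfM.
have pK := natr_neq0 pp0.
move: pnm; set c1 : K := 'C(p * n, p * m)%:R; set c2 : K := 'C(n, m)%:R => pnm.
rewrite mulrACA (mulfV pK) mul1r -mulrBr {}pnm addrAC subrr add0r.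
rewrite !(absvalM hv) (absvalV hv) absval_expp (vp n0) -mulrA.
rewrite ler_piMr ?absval_ge0 // invrK mulrCA.
rewrite mulr_ile1 ?(absval_intr_le1 hv) ?(absval_ge0 hv) //.
by rewrite ler_pdivrMr ?exprn_gt0 // mul1r ler_weXn2l.
Qed.

(** Telescoping: passing from [D] to [D.+1] costs at most the absolute value of [p ^ D * m]. *)
Lemma absval_bin_pred_mul_exp D n m : (0 < n)%N -> (0 < m)%N ->
  v ('C((p ^ D * n).-1, (p ^ D * m).-1)%:R - 'C(n.-1, m.-1)%:R) <= v m%:R.
Proof.
move=> n0 m0; elim: D => [|D IH].
  by rewrite !mul1n subrr absval0 // absval_ge0.
rewrite -(subrK 'C((p ^ D * n).-1, (p ^ D * m).-1)%:R 'C(_, _)%:R) -addrA.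
apply: absvalD_le => //; rewrite !expnS -!mulnA.
apply: le_trans (absval_bin_pred_mul _ _) _.
- by rewrite muln_gt0 expn_gt0 prime_gt0.
- by rewrite muln_gt0 expn_gt0 prime_gt0.
- by rewrite natrM absvalM // ler_piMl ?absval_ge0 // absval_natr_le1.
Qed.

Lemma absval_fleck_sum_le1 q n : v (fleck_sum K q n) <= 1.
Proof.
apply: (absval_sum_le hv) => // d _.
by rewrite absvalM // absvalX // absvalN // absval1 // expr1n mul1r absval_natr_le1.
Qed.

Lemma absval_fleck_sum_ndvd s t n : ~~ (p ^ t %| n.+1)%N ->
  v (fleck_sum K (p ^ s) n) <= p%:R ^+ t / p%:R ^+ s.
Proof.
move=> tn; apply: (absval_sum_le hv) => [|d _].
  by rewrite mulr_ge0 ?invr_ge0 ?exprn_ge0 // ltW.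
rewrite absvalM // absvalX // absvalN // absval1 // expr1n mul1r.
have dp : (0 < d.+1 * p ^ s)%N by rewrite muln_gt0 expn_gt0 (prime_gt0 p_prime).
have := mul_bin_diag n.+1 (d.+1 * p ^ s).-1; rewrite prednK //= => E.
have H := absval_dvd_ndvd_le tn (dvdn_mull d.+1 (dvdnn (p ^ s))) E; apply: (le_trans H).
by rewrite ler_pM2r ?invr_gt0 ?exprn_gt0 // ler_weXn2l // leq_pred.
Qed.

(** The terms of equal index [d] are compared, after the second sum is padded with zeros to the
    length of the first. *)
Lemma absval_fleck_sum_mul s D n :
  v (fleck_sum K (p ^ (s + D)) (n.+1 * p ^ D).-1 - fleck_sum K (p ^ s) n)
    <= p%:R ^- s.
Proof.
have q0 k : (0 < p ^ k)%N by rewrite expn_gt0 prime_gt0.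
have N0 : (0 < n.+1 * p ^ D)%N by rewrite muln_gt0 q0.
rewrite (@fleck_sum_widen _ (p ^ s) n (n.+1 * p ^ D)) // ?leq_pmulr //.
rewrite /fleck_sum prednK // -sumrB; apply: (absval_sum_le hv) => [|d _].
  by rewrite invr_ge0 exprn_ge0 // ltW.
have dE : (d.+1 * p ^ (s + D) = p ^ D * (d.+1 * p ^ s))%N.
  by rewrite expnD mulnA mulnC.
(* As [p] is odd, [d.+1 * p ^ k] has the parity of [d.+1], so the sign is independent of [k]. *)
have sgnE k : (-1) ^+ (d.+1 * p ^ k).-1 = (-1) ^+ d :> K.
  rewrite -signr_odd -[RHS]signr_odd; congr ((-1) ^+ (nat_of_bool _)).
  have /(congr1 odd) : (d.+1 * p ^ k = (d.+1 * p ^ k).-1.+1)%N.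
    by rewrite prednK // muln_gt0 q0.
  by rewrite oddM oddX p_odd orbT andbT /= => /negb_inj.
rewrite !sgnE -mulrBr absvalM // absvalX // absvalN // absval1 // expr1n mul1r.
rewrite dE mulnC.
apply: le_trans (absval_bin_pred_mul_exp D (ltn0Sn n) _) _.
  by rewrite muln_gt0 q0.
by rewrite absval_dvd_le // dvdn_mull.
Qed.

(** In the binomial expansion the extreme terms are [1] and [-1], the exponent being odd, and
    cancel. The inner binomials are divisible by [p]. *)
Lemma absval_unity_sub_exp s z : z ^+ (p ^ s) = 1 ->
  v (1 - z) ^+ (p ^ s) <= p%:R^-1.
Proof.
move=> zq; have q0 : (0 < p ^ s)%N by rewrite expn_gt0 prime_gt0.
have vz := absval_unity hv q0 zq.
have odd_q : odd (p ^ s) by rewrite oddX p_odd orbT.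
have [m qE] : exists m, (p ^ s)%N = m.+1 by exists (p ^ s).-1; rewrite prednK.
rewrite qE -absvalX // exprBn big_ord_recl big_ord_recr /= bin0 expr1n !mul1r.
rewrite /bump /= add1n binn subnn -qE zq -signr_odd odd_q !expr1 expr0 !mulr1.
rewrite !mulr1n addrCA subrr addr0.
apply: (absval_sum_le hv) => [|i _]; first by rewrite invr_ge0 ltW.
rewrite expr1n mulr1 -[_ *+ 'C(_, _)]mulr_natr !(absvalM hv) !(absvalX hv).
rewrite vz (absvalN hv) (absval1 hv) !expr1n !mul1r /bump /= add1n.
have iq : (i.+1 < p ^ s)%N by rewrite qE ltnS ltn_ord.
have is' : ~~ (p ^ s %| i.+1)%N by rewrite gtnNdvd.
have s0 : (0 < s)%N by case: (s) is' iq => //; rewrite expn0 dvd1n.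
apply: le_trans (absval_dvd_ndvd_le is' (dvdnn _) (esym (mul_bin_diag _ _))) _.
rewrite -{2}(prednK s0) exprSr invfM mulrA mulfV ?mul1r //.
Qed.

Lemma absval_unity_sub_expn_le s n z : z ^+ (p ^ s) = 1 ->
  v (1 - z) ^+ n <= p%:R ^- (n %/ p ^ s).
Proof.
move=> zq; have q0 : (0 < p ^ s)%N by rewrite expn_gt0 prime_gt0.
have v1z : v (1 - z) <= 1.
  by rewrite absvalB_le ?absval1 // (absval_unity hv q0 zq).
rewrite {1}(divn_eq n (p ^ s)) exprD mulnC exprM.
rewrite -[leRHS]mulr1 -exprVn ler_pM ?exprn_ge0 ?absval_ge0 //.
  apply: lerXn2r (absval_unity_sub_exp zq); rewrite nnegrE ?invr_ge0 ?(ltW p0) //.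
  by rewrite exprn_ge0 // absval_ge0.
by rewrite exprn_ile1 ?absval_ge0.
Qed.

Lemma absval_unity_sub_lt1 s z : z ^+ (p ^ s) = 1 -> v (1 - z) < 1.
Proof.
move=> zq; have q0 : (0 < p ^ s)%N by rewrite expn_gt0 prime_gt0.
rewrite ltNge; apply/negP => /(exprn_ege1 (p ^ s)) h.
have := le_trans h (absval_unity_sub_exp zq).
by rewrite leNgt invf_lt1 // ltr1n prime_gt1.
Qed.

Lemma absval_fleck_sum_geo s n (z : K) : (p ^ s).-primitive_root z ->
  v (fleck_sum K (p ^ s) n) <= p%:R ^+ s / p%:R ^+ (n %/ p ^ s).
Proof.
move=> zq; have q0 : (0 < p ^ s)%N by rewrite expn_gt0 prime_gt0.
rewrite -(fleck_sumE _ zq) ?natr_neq0 // absvalM // absvalV // absval_expp invrK.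
rewrite ler_pM2l ?exprn_gt0 //.
apply: (absval_sum_le hv) => [|i _]; first by rewrite invr_ge0 exprn_ge0 ?ltW.
have ziq : (z ^+ i) ^+ (p ^ s) = 1 by rewrite exprAC (prim_expr_order zq) expr1n.
rewrite absvalM // (absval_unity hv q0 ziq) mul1r absvalX //.
exact: absval_unity_sub_expn_le.
Qed.

End Padic.

(** * Limits with respect to an ultrametric absolute value *)

Lemma uniform_eventually (q : nat) (P : 'I_q -> nat -> Prop) :
  (forall i, exists N, forall n, (N <= n)%N -> P i n) ->
  exists N, forall i n, (N <= n)%N -> P i n.
Proof.
move=> /choice[N NP]; exists (\max_i N i)%N => i n Nn.
by apply: NP; apply: leq_trans (leq_bigmax i) Nn.
Qed.

Section VLimits.
Variables (R : realType) (K : fieldType) (v : K -> R) (hv : is_absval v).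

Lemma v_cvgP (u : nat -> K) l : v_cvg v u l <->
  forall e, 0 < e -> exists N, forall n, (N <= n)%N -> v (u n - l) < e.
Proof.
split=> [ul e e0|H].
  have /cvgrPdist_lt /(_ e e0)[N _ NP] := ul.
  by exists N => n Nn; have := NP n Nn; rewrite sub0r normrN ger0_norm ?absval_ge0.
apply/cvgrPdist_lt => e e0; have [N NP] := H e e0.
by exists N => // n Nn /=; rewrite sub0r normrN ger0_norm ?absval_ge0 // NP.
Qed.

Lemma v_cauchy_step (u : nat -> K) :
  (forall e, 0 < e -> exists N, forall n, (N <= n)%N -> v (u n.+1 - u n) < e) ->
  v_cauchy v u.
Proof.
move=> H e e0; have [N NP] := H e e0; exists N.
have inc m k : (N <= m)%N -> v (u (m + k)%N - u m) < e.
  move=> Nm; elim: k => [|k IH]; first by rewrite addn0 subrr absval0.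
  rewrite addnS -(subrK (u (m + k)%N) (u _.+1)) -addrA.
  apply: le_lt_trans (absvalD_max hv _ _) _; rewrite gt_max IH andbT.
  by apply: NP; rewrite (leq_trans Nm) // leq_addr.
move=> m n Nm Nn; have [mn|nm] := leqP m n.
  by rewrite absval_distC // -(subnKC mn) inc.
by rewrite -(subnKC (ltnW nm)) inc.
Qed.

Lemma v_cvg_series_term (d : nat -> K) l : v_cvg v (fun N => \sum_(0 <= n < N) d n) l ->
  forall e, 0 < e -> exists N, forall n, (N <= n)%N -> v (d n) < e.
Proof.
move=> /v_cvgP H e /H[N NP]; exists N => n Nn.
have -> : d n = (\sum_(0 <= i < n.+1) d i - l) - (\sum_(0 <= i < n) d i - l).
  by rewrite big_nat_recr //=; ring.
apply: le_lt_trans (absvalD_max hv _ _) _; rewrite absvalN // gt_max.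
by rewrite !NP // ltnW.
Qed.

End VLimits.

(** * Coefficients of a bounded power series *)

Section CoefficientBound.
Variables (R : realType) (p : nat) (p_prime : prime p).
Variables (K : fieldType) (v : K -> R) (hv : is_absval v).
Hypothesis vp : extends_padic p v.
Hypothesis has_prim : forall n, (0 < n)%N -> exists z : K, n.-primitive_root z.
Hypothesis has_root_p : forall n, exists t : K, t ^+ n.+1 = p%:R.

(* Averaging [z^(-n) g(z x)] over the [m]-th roots of unity [z], with [m] large
   and prime to [p], isolates [c n * x^n] up to terms of index at least [m]. *)
Lemma absval_term_le (c : nat -> K) (g : K -> K) (x : K) (M : R) :
  (forall y, v y = v x ->
     v_cvg v (fun N => \sum_(0 <= n < N) c n * y ^+ n) (g y) /\ v (g y) <= M) ->
  forall n, v (c n * x ^+ n) <= M.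
Proof.
move=> gy n; apply/ler_addgt0Pr => e e0.
have [J JP] := v_cvg_series_term hv (gy x erefl).1 e0.
(* [m] is prime to [p], so dividing by it preserves absolute values, and it exceeds [J], from which
   index on the terms are below [e]. *)
pose m := (p * (J + n)).+1.
have m0 : (0 < m)%N by [].
have [z zm] := has_prim m0.
have vm : v m%:R = 1.
  rewrite vp // lognE p_prime /= /m -addn1 dvdn_addr ?dvdn_mulr //.
  by rewrite dvdn1 (gtn_eqF (prime_gt1 p_prime)) expr0 invr1.
have mK : m%:R != 0 :> K by apply: natr_neq0 p_prime _ _ hv vp _ m0.
have Jm : (J + n < m)%N by rewrite ltnS leq_pmull // prime_gt0.
have vz i : v (z ^+ i) = 1.
  by apply: (absval_unity hv m0); rewrite exprAC (prim_expr_order zm) expr1n.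
have vzx i : v (z ^+ i * x) = v x by rewrite absvalM // vz mul1r.
have M0 : 0 <= M by apply: le_trans (absval_ge0 hv _) (gy x erefl).2.
(* There are finitely many points, so one truncation serves them all. *)
have [L0 L0P] : exists L0, forall (i : 'I_m) L, (L0 <= L)%N ->
    v (\sum_(0 <= j < L) c j * (z ^+ i * x) ^+ j) <= M + e.
  apply: uniform_eventually => i; have [cv gM] := gy _ (vzx i).
  have [N NP] := (v_cvgP hv _ _).1 cv e e0; exists N => L /NP vL.
  rewrite -(subrK (g (z ^+ i * x)) (\sum_(0 <= j < L) _)).
  apply: (absvalD_le hv); first by rewrite (le_trans (ltW vL)) // lerDr.
  by rewrite (le_trans gM) // lerDl ltW.
pose L := maxn L0 n.+1.
(* The exponent [m - n] plays the part of [- n], the order of [z] being [m]. *)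
have avg : m%:R^-1 * \sum_(i < m) z ^+ (i * (m - n)) *
             \sum_(0 <= j < L) c j * (z ^+ i * x) ^+ j
         = \sum_(0 <= j < L | (m %| m - n + j)%N) c j * x ^+ j.
  under eq_bigr do rewrite mulr_sumr.
  rewrite exchange_big /= mulr_sumr [RHS]big_mkcond /=; apply: eq_bigr => j _.
  rewrite (eq_bigr (fun i : 'I_m => c j * x ^+ j * z ^+ (i * (m - n + j)))).
    rewrite -mulr_sumr sum_prim_root_expr //.
    by case: ifP; rewrite ?mulr0 // mulrCA mulVf ?mulr1.
  by move=> i _; rewrite mulnDr exprD exprMn -exprM; ring.
have : v (\sum_(0 <= j < L | (m %| m - n + j)%N) c j * x ^+ j) <= M + e.
  rewrite -avg absvalM // absvalV // vm invr1 mul1r.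
  apply: (absval_sum_le hv) => [|i _]; first by rewrite addr_ge0 // ltW.
  by rewrite absvalM // exprM exprAC -exprM vz mul1r L0P // leq_maxl.
have nL : (n < L)%N by rewrite leq_maxr.
have nm : (n <= m)%N by rewrite (leq_trans _ (ltnW Jm)) // leq_addl.
rewrite big_mkord (bigD1 (Ordinal nL)) /= ?subnK //.
set T := (X in _ + X) => vT.
rewrite -(addrK T (c n * _)); apply: (absvalB_le hv) => //.
apply: (absval_sum_le hv) => [|j /andP[mj jn]]; first by rewrite addr_ge0 // ltW.
(* A surviving [j] other than [n] is congruent to [n] modulo [m], hence at least [m], and so beyond
   [J]. *)
rewrite (le_trans (ltW (JP j _))) ?lerDr // leqNgt; apply: contra jn => jJ.
case/dvdnP: mj => -[|[|k]] mk; first by lia.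
  by apply/eqP/val_inj => /=; lia.
by move: mk; rewrite !mulSn; lia.
Qed.

(** The radius [v r] itself is excluded, so the estimate is made at radius [v (r * t)] with
    [t ^+ n.+1 = p]. As [v t ^+ n] is at least [1 / p], the loss is a factor [p], uniformly in
    [n]. *)
Lemma bounded_coef (c : nat -> K) (g : K -> K) (r : K) (M : R) : r != 0 ->
  (forall y, v y < v r ->
     v_cvg v (fun N => \sum_(0 <= n < N) c n * y ^+ n) (g y) /\ v (g y) <= M) ->
  forall n, v (c n) * v r ^+ n <= p%:R * M.
Proof.
move=> r0 gy n; have [t tp] := has_root_p n.
have vr0 := absval_gt0 hv r0.
have vtn : v t ^+ n.+1 = p%:R^-1.
  rewrite -absvalX // tp vp ?prime_gt0 // lognE p_prime prime_gt0 //= dvdnn.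
  by rewrite divnn prime_gt0 //= logn1 expr1.
have vt1 : v t < 1.
  rewrite ltNge; apply/negP => /(exprn_ege1 n.+1).
  by rewrite vtn leNgt invf_lt1 ?ltr1n ?prime_gt1 // ltr0n prime_gt0.
have vrt : v (r * t) < v r by rewrite absvalM // gtr_pMr.
have H0 : v (c n * (r * t) ^+ n) <= M.
  by apply: (absval_term_le (g := g)) => y yrt; apply: gy; rewrite yrt.
move: H0; rewrite !absvalM // absvalX // absvalM // exprMn => H0.
rewrite -ler_pdivrMl ?ltr0n ?prime_gt0 // -vtn; apply: le_trans H0.
rewrite mulrC mulrA ler_wpM2l ?mulr_ge0 ?exprn_ge0 ?absval_ge0 //.
by rewrite exprS ler_piMl ?exprn_ge0 ?absval_ge0 // ltW.
Qed.

End CoefficientBound.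

(** * Roots of unity in C_p and approximation of the arc sums *)

(** The polynomial ['X^n - 1] is separable, so it has [n] distinct roots, and a group of [n] roots
    of unity is cyclic. *)
Lemma closed_field_prim_root (F : closedFieldType) n :
  n%:R != 0 :> F -> exists z : F, n.-primitive_root z.
Proof.
move=> nF; have n0 : (0 < n)%N by case: n nF => //; rewrite eqxx.
have [rs] := closed_field_poly_normal ('X^n - 1 : {poly F}).
rewrite lead_coefXnsubC // scale1r => rsE.
have := separable_Xn_sub_1 nF; rewrite rsE separable_prod_XsubC => uniq_rs.
have size_rs : size rs = n.
  by have := size_XnsubC (1 : F) n0; rewrite polyC1 rsE size_prod_XsubC => -[].
have : all n.-unity_root rs.
  by apply/allP => z zrs; rewrite /root_of_unity rsE root_prod_XsubC.
move=> /(has_prim_root n0)/(_ uniq_rs); rewrite size_rs leqnn => /(_ isT)/hasP[z _ zn].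
by exists z.
Qed.

Section PadicComplex.
Variables (R : realType) (p : nat) (p_prime : prime p) (Cp : padicComplex R p).
Local Notation v := (@pc_abs R p Cp).
Let hv : is_absval v := pc_absP Cp.

Lemma pc_Qpalg_padic : extends_padic p (@pc_Qpalg_abs R p Cp).
Proof.
move=> n n0; rewrite -(rmorph_nat (pc_Qp_Qpalg Cp)) pc_Qp_Qpalg_isom.
rewrite -(rmorph_nat (pc_Q_Qp Cp)) (completion_isom (pc_Qp_completion Cp)).
rewrite /padic_absq pnatr_eq0 (gtn_eqF n0).
have -> : n%:R = n%:Z%:Q :> rat by rewrite -pmulrn.
by rewrite numq_int denq_int logn1 sub0r -exprnN.
Qed.

Lemma pc_abs_padic : extends_padic p v.
Proof.
move=> n n0; rewrite -(rmorph_nat (pc_Qpalg_Cp Cp)).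
by rewrite (completion_isom (pc_Cp_completion Cp)) pc_Qpalg_padic.
Qed.

(** [Cp] is given as a mere field, so the root is found in the closed field [pc_Qpalg Cp] and mapped
    over. *)
Lemma pc_prim_root n : (0 < n)%N -> exists z : Cp, n.-primitive_root z.
Proof.
move=> n0.
have /closed_field_prim_root[z zn] : n%:R != 0 :> pc_Qpalg Cp.
  exact: natr_neq0 p_prime _ _ (pc_Qpalg_absP Cp) pc_Qpalg_padic _ n0.
by exists (pc_Qpalg_Cp Cp z); rewrite fmorph_primitive_root.
Qed.

Lemma pc_root_p n : exists t : Cp, t ^+ n.+1 = p%:R.
Proof.
have [t tE] := @solve_monicpoly (pc_Qpalg Cp) n.+1
  (fun i => if i == 0%N then p%:R else 0) (ltn0Sn n).
exists (pc_Qpalg_Cp Cp t); rewrite -rmorphXn tE big_ord_recl /= mulr1.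
by rewrite big1 ?addr0 ?rmorph_nat // => i _; rewrite mul0r.
Qed.

Lemma fsbig_unity_roots (q : nat) (z : Cp) (F : Cp -> Cp) : q.-primitive_root z ->
  \sum_(x \in [set x : Cp | x ^+ q = 1]) F x = \sum_(i < q) F (z ^+ i).
Proof.
move=> zq; rewrite (fsbig_ord _ _ (fun i => F (z ^+ i))).
apply: (reindex_fsbig (fun i => z ^+ i)); split.
- by move=> i /= _; rewrite exprAC (prim_expr_order zq) expr1n.
- move=> i j; rewrite !inE /= => iq jq /eqP.
  by rewrite (eq_prim_root_expr zq) !modn_small // => /eqP.
- by move=> x /= /(prim_rootP zq)[i ->]; exists i => //=.
Qed.

Variables (p_odd : odd p) (a b : Cp) (ab : a <> b).
Variables (f : Cp -> Cp) (c : nat -> Cp) (fc : expansion_on_arc a b f c).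
Let r := a - b.

Lemma bounded_on_arc_coef : bounded_on_arc a b f ->
  exists M, forall n, v (c n) * v r ^+ n <= M.
Proof.
move=> [M fM]; exists (p%:R * M); apply: (bounded_coef p_prime hv pc_abs_padic
  pc_prim_root pc_root_p (g := fun y => f (y + b))).
  by rewrite subr_eq0; apply/eqP.
move=> y yr; have yA : padic_arc a b (y + b) by rewrite /padic_arc /= addrK.
by split; [have := fc yA; rewrite addrK | apply: fM].
Qed.

(** For fixed [k] finitely many points occur, so one truncation of the power series serves them all
    and the finite sums can be exchanged. The plus sign comes from [x - a = - r * zeta]. *)
Lemma arc_sum_approx phi k e : 0 < e -> exists L0, forall L, (L0 <= L)%N ->
  v (arc_sum a b f phi k
     + \sum_(0 <= n < L) c n * r ^+ n.+1 * fleck_sum Cp (p ^ phi k) n) <= e.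
Proof.
move=> e0; set q := (p ^ phi k)%N.
have q0 : (0 < q)%N by rewrite expn_gt0 prime_gt0.
have qK : q%:R != 0 :> Cp by apply: natr_neq0 p_prime _ _ hv pc_abs_padic _ q0.
have [z zq] := pc_prim_root q0.
have zi i : (z ^+ i) ^+ q = 1 by rewrite exprAC (prim_expr_order zq) expr1n.
have r0 : r != 0 by rewrite subr_eq0; apply/eqP.
have vr0 := absval_gt0 hv r0.
pose x i := a + (b - a) * z ^+ i.
have xbE i : x i - b = r * (1 - z ^+ i) by rewrite /x /r; ring.
have xA i : padic_arc a b (x i).
  rewrite /padic_arc /= xbE absvalM // gtr_pMr //.
  exact: (absval_unity_sub_lt1 p_prime p_odd hv pc_abs_padic (zi i)).
(* The factor by which weighting and averaging can magnify an error made in [f (x i)]. *)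
pose d := v r / v q%:R.
have d0 : 0 < d by rewrite divr_gt0 ?absval_gt0.
have [L0 L0P] : exists L0, forall (i : 'I_q) L, (L0 <= L)%N ->
    v (f (x i) - \sum_(0 <= n < L) c n * (x i - b) ^+ n) <= e / d.
  apply: uniform_eventually => i.
  have [N NP] := (v_cvgP hv _ _).1 (fc (xA i)) (e / d) (divr_gt0 e0 d0).
  by exists N => L /NP; rewrite absval_distC // => /ltW.
exists L0 => L LL0.
have -> : arc_sum a b f phi k = - (q%:R^-1 * \sum_(i < q) r * z ^+ i * f (x i)).
  rewrite /arc_sum -natrX -/q (fsbig_unity_roots _ zq) -mulrN -sumrN.
  by congr (_ * _); apply: eq_bigr => i _; rewrite -/(x i) /x /r; ring.
have -> : \sum_(0 <= n < L) c n * r ^+ n.+1 * fleck_sum Cp q n =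
   q%:R^-1 * \sum_(i < q) r * z ^+ i * \sum_(0 <= n < L) c n * (x i - b) ^+ n.
  under [in RHS]eq_bigr do rewrite mulr_sumr.
  rewrite exchange_big mulr_sumr /=; apply: eq_bigr => n _.
  rewrite -(fleck_sumE n zq qK) mulrCA; congr (_ * _).
  by rewrite mulr_sumr; apply: eq_bigr => i _; rewrite xbE exprMn exprS; ring.
rewrite addrC -mulrBr -sumrB absvalM // absvalV //.
rewrite ler_pdivrMl ?absval_gt0 //; apply: (absval_sum_le hv) => [|i _].
  by rewrite mulr_ge0 ?absval_ge0 // ltW.
rewrite -mulrBr !absvalM // (absval_unity hv q0 (zi i)) mulr1.
rewrite (absval_distC hv _ (f _)).
apply: le_trans (ler_wpM2l (ltW vr0) (L0P i L LL0)) _.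
by rewrite /d invf_div mulrCA (mulrC (v q%:R)) mulVKf ?lt0r_neq0 // mulrC.
Qed.

End PadicComplex.

(** * Real estimates: decay against the growth of the coefficients *)

Lemma sqrn_le_exp3 n : (n * n <= 3 ^ n)%N.
Proof.
elim: n => [|[|[|n]] IH] //.
by rewrite expnS; apply: leq_trans (leq_mul (leqnn 3) IH); lia.
Qed.

(** Of the exponent [J], a part [3 * s] is set aside to absorb the factors [p ^ s] and [p ^ s.*2] of
    [powR_mul_decay]. The rest [i] exceeds [3 * s], so the left side is at most [i * i <= 3 ^ i]. *)
Lemma decay_index (p s J : nat) : (2 < p)%N -> (0 < s)%N -> (6 * s < J)%N ->
  exists2 i, J = (i + (s + s.*2))%N &
    (s * (i + (s + s.*2)).+1 <= p ^ i)%N.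
Proof.
move=> p2 s0 J6; exists (J - (s + s.*2))%N; first by lia.
set i := (J - _)%N; have si : (3 * s < i)%N by rewrite /i; lia.
apply: leq_trans (leq_trans (sqrn_le_exp3 i) _); last first.
  by rewrite leq_exp2r // (leq_ltn_trans _ si).
by move: i si => i si; apply: leq_trans (_ : s * (2 * i) <= _)%N; nia.
Qed.

Lemma powR_logb (R : realType) (p : nat) (x : R) : (1 < p)%N -> 0 < x ->
  p%:R `^ logb p x = x.
Proof.
move=> p1 x0; have lnp : ln (p%:R : R) != 0.
  by rewrite lt0r_neq0 // ln_gt0 // ltr1n.
rewrite /powR pnatr_eq0 (gtn_eqF (ltnW p1)) /logb.
by rewrite divfK // lnK.
Qed.

(** If [J <= 6 * s], then [N] is at most [7 * s * p ^ s], and the bound on [X] by [e] gives the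
    first member; 7 to the power [beta] is at most 7. If [J] is larger, the exponential decay in [J]
    beats [N] itself and leaves [1 / s]. *)
Lemma powR_mul_decay (R : realType) (p s J N : nat) (beta e X : R) :
  (2 < p)%N -> (0 < s)%N -> (0 < N)%N -> (N <= J.+1 * p ^ s)%N ->
  0 <= beta -> beta <= 1 -> 0 <= X -> X <= p%:R `^ (- e) ->
  X <= p%:R ^+ s.*2 / p%:R ^+ J ->
  N%:R `^ beta * X <=
  Num.max (7 * p%:R `^ (beta * s%:R + beta * logb p s%:R - e)) s%:R^-1.
Proof.
move=> p2 s0 N0 NJ b0 b1 X0 Xe XJ; rewrite le_max.
have pR0 : 0 < p%:R :> R by rewrite ltr0n (ltn_trans _ p2).
have [J6|J6] := leqP J (6 * s); apply/orP; [left|right].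
  have N7 : N%:R <= 7 * (s%:R * p%:R ^+ s) :> R.
    rewrite -natrX -!natrM ler_nat (leq_trans NJ) // mulnA leq_mul2r.
    by rewrite (leq_ltn_trans J6) ?orbT // ltn_mul2r s0.
  rewrite powRD; last by rewrite (gt_eqF pR0) implybT.
  rewrite mulrA ler_pM ?powR_ge0 //.
  apply: le_trans (_ : (7 * (s%:R * p%:R ^+ s)) `^ beta <= _).
    by rewrite ge0_ler_powR ?nnegrE ?mulr_ge0 ?exprn_ge0 // ltW.
  rewrite powRM ?mulr_ge0 ?exprn_ge0 ?(ltW pR0) //.
  rewrite powRM ?exprn_ge0 ?(ltW pR0) //.
  rewrite powRD; last by rewrite (gt_eqF pR0) implybT.
  rewrite mulrC [beta * logb _ _]mulrC [beta * s%:R]mulrC (powRrM _ s%:R) (powRrM _ (logb _ _)).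
  rewrite powR_logb ?ltr0n ?(ltn_trans _ p2) // powR_mulrn ?(ltW pR0) //.
  rewrite [leLHS]mulrC [s%:R `^ _ * _]mulrC ler_wpM2r ?mulr_ge0 ?powR_ge0 //.
  rewrite -[leRHS]powRr1 //; apply: ler_powR => //; lra.
have NN : N%:R `^ beta <= N%:R :> R.
  by rewrite -[leRHS]powRr1 // ler_powR // ler1n.
apply: le_trans (_ : (J.+1 * p ^ s)%:R * (p%:R ^+ s.*2 / p%:R ^+ J) <= _).
  by rewrite ler_pM ?powR_ge0 // (le_trans NN) // ler_nat.
have [i iE iJ] := decay_index p2 s0 J6.
rewrite iE natrM natrX !exprD !invfM.
set u := p%:R ^+ s; set w := p%:R ^+ s.*2; set y := p%:R ^+ i.
have u0 : 0 < u by rewrite exprn_gt0.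
have w0 : 0 < w by rewrite exprn_gt0.
have y0 : 0 < y by rewrite exprn_gt0.
have -> : (i + (s + s.*2)).+1%:R * u * (w * (y^-1 * (u^-1 * w^-1)))
        = (i + (s + s.*2)).+1%:R / y.
  by field; rewrite !lt0r_neq0.
rewrite ler_pdivrMr // ler_pdivlMl ?ltr0n //.
by rewrite -natrM /y -natrX ler_nat iJ.
Qed.

Lemma powR_natB (R : realType) (p t s : nat) : (0 < p)%N ->
  p%:R `^ (t%:R - s%:R) = p%:R ^+ t / p%:R ^+ s :> R.
Proof.
move=> p0; rewrite powRD; last by rewrite pnatr_eq0 (gtn_eqF p0) implybT.
by rewrite powRN !powR_mulrn.
Qed.

Lemma logb_natM_le (R : realType) (p m n : nat) : (1 < p)%N -> (0 < m)%N ->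
  (0 < n)%N -> (n <= p * m)%N -> logb p (n%:R : R) <= logb p (m%:R : R) + 1.
Proof.
move=> p1 m0 n0 npm; have lnp : 0 < ln (p%:R : R) by rewrite ln_gt0 // ltr1n.
rewrite /logb -[X in _ + X](mulfV (lt0r_neq0 lnp)) -mulrDl ler_pM2r ?invr_gt0 //.
rewrite -lnM ?posrE ?ltr0n ?(ltnW p1) // ler_ln ?posrE ?mulr_gt0 ?ltr0n ?(ltnW p1) //.
by rewrite -natrM ler_nat mulnC.
Qed.

(** * Comparison of the series at two consecutive levels *)

Section FleckSeries.
Variables (R : realType) (p : nat) (p_prime : prime p) (p_odd : odd p).
Variables (K : fieldType) (v : K -> R) (hv : is_absval v).
Hypothesis vp : extends_padic p v.
Hypothesis has_prim : forall n, (0 < n)%N -> exists z : K, n.-primitive_root z.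
Variables (w : nat -> K) (M beta : R) (M0 : 0 <= M) (b0 : 0 <= beta) (b1 : beta <= 1).
Hypothesis wM : forall n, v (w n) <= M * n.+1%:R `^ beta.

(** The bound of [powR_mul_decay]; it is small when both [s] and [e - beta * s - beta * logb p s]
    are large. *)
Let decay (e : R) (s : nat) : R :=
  Num.max (7 * p%:R `^ (beta * s%:R + beta * logb p s%:R - e)) s%:R^-1.

Let p0 : (0 < p)%N. Proof. exact: prime_gt0. Qed.

Lemma absval_mul_decay (e : R) (s n : nat) x : (0 < s)%N ->
  v x <= p%:R `^ (- e) -> v x <= p%:R ^+ s.*2 / p%:R ^+ (n %/ p ^ s) ->
  v (w n * x) <= M * decay e s.
Proof.
move=> s0 xe xJ; rewrite absvalM //.
apply: le_trans (ler_wpM2r (absval_ge0 hv x) (wM n)) _.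
rewrite -mulrA ler_wpM2l //.
apply: powR_mul_decay xe xJ => //.
- by have := odd_prime_gt2 p_odd p_prime.
- by rewrite ltn_ceil // expn_gt0 p0.
- exact: absval_ge0.
Qed.

Lemma absval_fleck_sum_geo2 s n :
  v (fleck_sum K (p ^ s) n) <= p%:R ^+ s / p%:R ^+ (n %/ p ^ s).
Proof.
have [|z zq] := has_prim (n := (p ^ s)%N); first by rewrite expn_gt0 p0.
exact: absval_fleck_sum_geo zq.
Qed.

(** The exponent [s.*2] leaves room for level [s + D] with [D <= s] beside level [s], so one decay
    estimate covers both. *)
Let weak_geo s s' m : (s' <= s.*2)%N ->
  p%:R ^+ s' / p%:R ^+ m <= p%:R ^+ s.*2 / p%:R ^+ m :> R.
Proof.
move=> ss'; rewrite ler_pM2r ?invr_gt0 ?exprn_gt0 ?ltr0n //.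
by rewrite ler_weXn2l // ler1n.
Qed.

Lemma absval_term_ndvd s t n : (0 < s)%N -> ~~ (p ^ t %| n.+1)%N ->
  v (w n * fleck_sum K (p ^ s) n) <= M * decay (s%:R - t%:R) s.
Proof.
move=> s0 tn; apply: absval_mul_decay => //.
  by rewrite opprB powR_natB // (absval_fleck_sum_ndvd p_prime hv vp).
apply: le_trans (absval_fleck_sum_geo2 s n) _.
by apply: weak_geo; rewrite -addnn leq_addr.
Qed.

Lemma absval_term_mul s D n : (0 < s)%N -> (D <= s)%N ->
  v (w n * (fleck_sum K (p ^ (s + D)) (n.+1 * p ^ D).-1 - fleck_sum K (p ^ s) n))
    <= M * decay s%:R s.
Proof.
move=> s0 Ds; apply: absval_mul_decay => //.
  rewrite powRN powR_mulrn //.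
  exact: (absval_fleck_sum_mul p_prime p_odd hv vp).
apply: (absvalB_le hv).
  apply: le_trans (absval_fleck_sum_geo2 _ _) _.
  (* The numerator is [n * p ^ D] plus the remainder [p ^ D - 1], so both levels have the same
     quotient. *)
  have -> : ((n.+1 * p ^ D).-1 %/ p ^ (s + D) = n %/ p ^ s)%N.
    rewrite addnC expnD divnMA; congr (_ %/ _)%N.
    have D0 : (0 < p ^ D)%N by rewrite expn_gt0 p0.
    rewrite mulSn -(prednK D0) addSn /= addnC divnMDl //.
    by rewrite divn_small ?addn0.
  by apply: weak_geo; rewrite -addnn leq_add2l.
apply: le_trans (absval_fleck_sum_geo2 s n) _.
by apply: weak_geo; rewrite -addnn leq_addr.
Qed.

(** Cutting the sums at [l * p ^ (t + D)] and [l * p ^ t] gives both the same number [l] of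
    divisible indices, which pairs them off exactly. *)
Lemma fleck_series_close (s D t : nat) (eps : R) : (0 < s)%N -> (D <= s)%N ->
  M * decay (s%:R - t%:R) s <= eps ->
  M * decay (s%:R - t%:R) (s + D) <= eps ->
  M * decay s%:R s <= eps ->
  (forall d, (0 < d)%N ->
     v (w (d * p ^ (t + D)).-1 - w (d * p ^ t).-1) <= eps) ->
  forall l, v (\sum_(0 <= n < l * p ^ (t + D)) w n * fleck_sum K (p ^ (s + D)) n
               - \sum_(0 <= n < l * p ^ t) w n * fleck_sum K (p ^ s) n) <= eps.
Proof.
move=> s0 Ds H1 H2 H3 H4 l.
have eps0 : 0 <= eps by apply: le_trans (absval_ge0 hv _) (H4 1%N isT).
rewrite (bigID (fun n => p ^ (t + D) %| n.+1)%N) /=.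
rewrite [X in _ - X](bigID (fun n => p ^ t %| n.+1)%N) /=.
rewrite !sum_multiples ?expn_gt0 ?p0 // opprD addrACA.
apply: (absvalD_le hv); last first.
  apply: (absvalB_le hv); apply: (absval_sum_le hv) => // n tn.
    (* The shift by [D] cancels in the exponent [(s + D) - (t + D)]. *)
    apply: le_trans H2; have := @absval_term_ndvd (s + D) (t + D) n.
    by rewrite !natrD opprD addrACA subrr addr0 addn_gt0 s0; apply.
  by apply: le_trans H1; apply: absval_term_ndvd.
rewrite -sumrB; apply: (absval_sum_le hv) => // d _.
set n := (d.+1 * p ^ t).-1; set n' := (d.+1 * p ^ (t + D)).-1.
have nE : n.+1 = (d.+1 * p ^ t)%N by rewrite prednK // muln_gt0 expn_gt0 p0.
have n'E : n' = (n.+1 * p ^ D).-1 by rewrite nE -mulnA -expnD.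
set F' := fleck_sum K (p ^ (s + D)) n'; set F := fleck_sum K (p ^ s) n.
(* The change of coefficient is multiplied by a sum of absolute value at most 1; the change of sum
   is covered by [absval_term_mul]. *)
have -> : w n' * F' - w n * F = (w n' - w n) * F' + w n * (F' - F) by ring.
apply: (absvalD_le hv).
  rewrite absvalM // -[eps]mulr1; apply: ler_pM; rewrite ?absval_ge0 //.
    exact: H4.
  exact: absval_fleck_sum_le1.
by apply: le_trans H3; rewrite /F' n'E; apply: absval_term_mul.
Qed.

End FleckSeries.

(** * Growth of the coefficients, choice of thresholds and conclusion *)

(** Merges the two cases into one bound valid from index 0 on; [n.+1] keeps the power at least 1
    there. *)
Lemma controlled_coef_growth (R : realType) (p : nat) (p_prime : prime p)
    (Cp : padicComplex R p) (a b : Cp) (ab : a <> b) (f : Cp -> Cp)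
    (c : nat -> Cp) (fc : expansion_on_arc a b f c) (beta : R) :
  (bounded_on_arc a b f /\ beta = 0) \/
    (controlled_coefficients a b c beta /\ 0 <= beta /\ beta < 1) ->
  exists2 M, 0 < M &
    forall n, pc_abs (c n * (a - b) ^+ n.+1) <= M * n.+1%:R `^ beta.
Proof.
have hv := pc_absP Cp; set r := a - b => fbeta.
suff [M HM] : exists M, forall n, pc_abs (c n) * pc_abs r ^+ n <= M * n.+1%:R `^ beta.
  exists (`|M| * pc_abs r + 1) => [|n].
    by rewrite ltr_wpDl // mulr_ge0 // absval_ge0.
  rewrite absvalM // absvalX // exprSr mulrA mulrDl mul1r ler_wpDr ?powR_ge0 //.
  rewrite [leRHS]mulrAC ler_wpM2r ?absval_ge0 // (le_trans (HM n)) //.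
  by rewrite ler_wpM2r ?powR_ge0 // ler_norm.
case: fbeta => [[fM ->]|[[M [n0 [n00 cM]]] [b0 b1]]].
  have [M HM] := bounded_on_arc_coef p_prime ab fc fM.
  by exists M => n; rewrite powRr0 mulr1.
(* [B] absorbs the finitely many coefficients up to the threshold [n0]. *)
pose B := \sum_(i < (Num.truncn n0).+1) pc_abs (c i) * pc_abs r ^+ i.
have B0 : 0 <= B by apply: sumr_ge0 => i _; rewrite mulr_ge0 ?exprn_ge0 ?absval_ge0.
have n1 n : 1 <= n.+1%:R `^ beta :> R by rewrite -[leLHS](powRr0 n.+1%:R) ler_powR // ler1n.
exists (`|M| + B) => n; have [nn0|n0n] := leqP n (Num.truncn n0).
  apply: le_trans (_ : B * n.+1%:R `^ beta <= _); last first.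
    by rewrite ler_wpM2r ?powR_ge0 // lerDr.
  apply: le_trans (_ : B <= _); last by rewrite ler_peMr.
  rewrite /B (bigD1 (Ordinal (n := _.+1) nn0)) //= lerDl.
  by apply: sumr_ge0 => i _; rewrite mulr_ge0 ?exprn_ge0 ?absval_ge0.
have /cM/ltW/le_trans -> // : n0 < n%:R.
  by apply: lt_le_trans (truncnS_gt n0) _; rewrite ler_nat.
apply: le_trans (_ : `|M| * n%:R `^ beta <= _).
  by rewrite ler_wpM2r ?powR_ge0 ?ler_norm.
by rewrite ler_pM ?powR_ge0 ?lerDl // ge0_ler_powR ?nnegrE // ler_nat.
Qed.

Lemma path_sequence_pinfty phi : path_sequence phi ->
  forall m, exists K, forall k, (K <= k)%N -> (m <= phi k)%N.
Proof.
move=> [k0 [_ H]] m; exists (k0 + m)%N => k; move=> /subnKC <-.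
suff incr j : (j <= phi (k0 + j))%N.
  by rewrite -addnA; apply: leq_trans (incr _); apply: leq_addr.
elim: j => // j IH; rewrite addnS.
by have [_] := H (k0 + j)%N (leq_addr _ _); apply: leq_trans.
Qed.

(** The two conditions make the two members of the maximum at most [eps / M]; in this form they
    follow from the growth of [phi] and [theta_lim]. *)
Lemma mul_decay_le (R : realType) (p s : nat) (M beta e eps : R) :
  (1 < p)%N -> 0 < M -> 0 < eps ->
  M <= eps * s%:R -> - logb p (eps / (7 * M)) <= e - beta * s%:R - beta * logb p s%:R ->
  M * Num.max (7 * p%:R `^ (beta * s%:R + beta * logb p s%:R - e)) s%:R^-1 <= eps.
Proof.
move=> p1 M0 e0 Ms He.
have s0 : 0 < s%:R :> R by rewrite -(pmulr_rgt0 _ e0) (lt_le_trans M0).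
rewrite -ler_pdivlMl // ge_max; apply/andP; split; last first.
  by rewrite -[leLHS]mul1r ler_pdivrMr // -mulrA ler_pdivlMl // mulr1.
rewrite -ler_pdivlMl //.
have -> : 7^-1 * (M^-1 * eps) = eps / (7 * M) by field; rewrite lt0r_neq0.
rewrite -[leRHS](@powR_logb _ p) ?divr_gt0 ?mulr_gt0 //.
by rewrite ler_powR ?ler1n 1?ltnW //; lra.
Qed.

(** Meant for [x = phi k] and [d = nabla phi k]: it yields the requirement [D <= s] of
    [fleck_series_close]. *)
Lemma le_of_path_bound (R : realType) (beta x d l : R) :
  0 <= beta -> 0 <= l -> 0 <= d -> 0 <= x - (beta + 1) * d - beta * l -> d <= x.
Proof.
by move=> b0 l0 d0; have := mulr_ge0 b0 l0; have := mulr_ge0 b0 d0; lra.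
Qed.

(** One inequality yields the exponents of all three decay bounds in [fleck_series_close]. The extra
    1 pays for replacing [ly] by [lx + 1], as [beta <= 1]. *)
Lemma decay_exponents (R : realType) (beta x y lx ly t C : R) :
  0 <= beta -> beta <= 1 -> x <= y -> 0 <= lx -> ly <= lx + 1 -> 0 <= t ->
  C + 1 <= x - beta * y - beta * lx - t ->
  [/\ C <= x - t - beta * x - beta * lx,
      C <= x - t - beta * y - beta * ly
    & C <= x - beta * x - beta * lx].
Proof.
move=> b0 b1 xy lx0 lyx t0 HC.
have := ler_wpM2l b0 xy; have := ler_wpM2l b0 lyx; rewrite mulrDr mulr1.
by split; lra.
Qed.

Theorem theorem4p15 (R : realType) (p : nat) (p_prime : prime p) (p_odd : odd p)
    (Cp : padicComplex R p) (a b : Cp) (ab : a <> b)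
    (f : Cp -> Cp) (c : nat -> Cp) (fc : expansion_on_arc a b f c)
    (beta : R)
    (f_beta : (bounded_on_arc a b f /\ beta = 0) \/
              (controlled_coefficients a b c beta /\ 0 <= beta /\ beta < 1))
    (phi : nat -> nat) (phi_path : path_sequence phi)
    (phi_lim : (phi k)%:R - (beta + 1) * (nabla phi k)%:R
                 - beta * logb p ((phi k)%:R : R) @[k --> \oo] --> +oo)
    (theta : nat -> nat) (theta_aux : auxiliary_function theta)
    (theta_lim : (phi k)%:R - beta * (phi k.+1)%:R
                 - beta * logb p ((phi k)%:R : R) - (theta k)%:R
                   @[k --> \oo] --> +oo)
    (coef_cauchy : forall eps : R, 0 < eps ->
       exists K : nat, forall k d : nat, (K < k)%N -> (0 < d)%N ->
         let m := (d * p ^ (theta k + nabla phi k))%N in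
         let n := (d * p ^ theta k)%N in
         pc_abs (c m.-1 * (a - b) ^+ m - c n.-1 * (a - b) ^+ n) < eps) :
  arc_integrable a b f phi.
Proof.
have hv := pc_absP Cp; have vp := pc_abs_padic Cp.
have p1 := prime_gt1 p_prime.
have [M M0 wM] := controlled_coef_growth p_prime ab fc f_beta.
have [b0 b1] : 0 <= beta /\ beta <= 1.
  by case: f_beta => [[_ ->]|[_ [? /ltW]]].
suff /(completion_complete (pc_Cp_completion Cp)) : v_cauchy (@pc_abs _ _ Cp) (arc_sum a b f phi).
  by [].
apply: (v_cauchy_step hv) => e e0; have e20 : 0 < e / 2 by rewrite divr_gt0.
(* The threshold of [mul_decay_le] for [eps = e / 2]. *)
pose C := - logb p (e / 2 / (7 * M)).
move/cvgryPge: phi_lim => /(_ 0)[N1 _ N1P].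
move/cvgryPge: theta_lim => /(_ (C + 1))[N2 _ N2P].
have [k0 [_ k0P]] := phi_path.
have [N3 N3P] := path_sequence_pinfty phi_path (Num.truncn (M / (e / 2))).+1.
have [N4 N4P] := coef_cauchy _ e20.
exists (maxn (maxn N1 N2) (maxn k0 (maxn N3 N4.+1))) => k; rewrite !geq_max.
move=> /andP[/andP[kN1 kN2] /and3P[kk0 kN3 kN4]].
have {N1P} phi_lim : 0 <= (phi k)%:R - (beta + 1) * (nabla phi k)%:R
  - beta * logb p ((phi k)%:R : R) by apply: N1P.
have {N2P} theta_lim : C + 1 <= (phi k)%:R - beta * (phi k.+1)%:R
  - beta * logb p ((phi k)%:R : R) - (theta k)%:R by apply: N2P.
have [s0 ss'] : (0 < phi k)%N /\ (phi k < phi k.+1)%N by apply: k0P.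
have sE : phi k.+1 = (phi k + nabla phi k)%N by rewrite subnKC // ltnW.
have M_le s : (phi k <= s)%N -> M <= e / 2 * s%:R.
  move=> ks; rewrite -ler_pdivrMl // mulrC.
  apply: le_trans (ltW (truncnS_gt _)) _; rewrite ler_nat.
  by apply: leq_trans ks; apply: N3P.
have log0 : 0 <= logb p ((phi k)%:R : R).
  by rewrite divr_ge0 ?ln_ge0 // ler1n // ltnW.
have Ds : (nabla phi k <= phi k)%N.
  by rewrite -(ler_nat R) (le_of_path_bound b0 log0 _ phi_lim).
(* Since [nabla phi k <= phi k], the next value [phi k.+1] is at most [2 * phi k], hence at most
   [p * phi k]. *)
have log_le : logb p ((phi k.+1)%:R : R) <= logb p ((phi k)%:R : R) + 1.
  apply: logb_natM_le => //; first exact: ltn_trans ss'.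
  apply: leq_trans (_ : 2 * phi k <= _)%N; last by rewrite leq_mul2r p1 orbT.
  by rewrite sE mul2n -addnn leq_add2l.
have s_le : (phi k)%:R <= (phi k.+1)%:R :> R by rewrite ler_nat ltnW.
have [C1 C2 C3] := decay_exponents b0 b1 s_le log0 log_le (ler0n R (theta k)) theta_lim.
have close := fleck_series_close p_prime p_odd hv vp
  (@pc_prim_root _ _ p_prime Cp) (ltW M0) b0 b1 wM s0 Ds (t := theta k)
  (eps := e / 2).
rewrite -sE in close.
have /close {}close : M * Num.max (7 * p%:R `^ (beta * (phi k)%:R +
   beta * logb p (phi k)%:R - ((phi k)%:R - (theta k)%:R))) (phi k)%:R^-1 <= e / 2.
  by apply: mul_decay_le => //; apply: M_le.
have /close {}close : M * Num.max (7 * p%:R `^ (beta * (phi k.+1)%:R +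
   beta * logb p (phi k.+1)%:R - ((phi k)%:R - (theta k)%:R))) (phi k.+1)%:R^-1 <= e / 2.
  by apply: mul_decay_le => //; apply: M_le; exact: ltnW.
have /close {}close : M * Num.max (7 * p%:R `^ (beta * (phi k)%:R +
   beta * logb p (phi k)%:R - (phi k)%:R)) (phi k)%:R^-1 <= e / 2.
  by apply: mul_decay_le => //; apply: M_le.
have {}close l : pc_abs
    (\sum_(0 <= n < l * p ^ (theta k + nabla phi k)) c n * (a - b) ^+ n.+1 *
       fleck_sum Cp (p ^ phi k.+1) n
     - \sum_(0 <= n < l * p ^ theta k) c n * (a - b) ^+ n.+1 *
       fleck_sum Cp (p ^ phi k) n) <= e / 2.
  apply: close => d d0; have := N4P k d; rewrite !prednK ?muln_gt0 ?d0 ?expn_gt0 ?(ltnW p1) //.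
  by move=> H; apply/ltW/H.
have [L1 L1P] := arc_sum_approx p_prime p_odd ab fc phi k e20.
have [L2 L2P] := arc_sum_approx p_prime p_odd ab fc phi k.+1 e20.
(* Both truncations then lie beyond the thresholds of [arc_sum_approx]. *)
pose l := maxn L1 L2.
have lp m : (l <= l * p ^ m)%N by rewrite leq_pmulr // expn_gt0 ltnW.
have := L1P (l * p ^ theta k)%N (leq_trans (leq_maxl _ _) (lp _)).
have := L2P (l * p ^ (theta k + nabla phi k))%N (leq_trans (leq_maxr _ _) (lp _)).
move: (close l); set P1 := \sum_(_ <= _ < _) _; set P2 := \sum_(_ <= _ < _) _.
(* Three errors of at most [e / 2] combine to at most [e / 2]; the halving only makes the inequality
   strict. *)
move=> h h2 h1; apply: le_lt_trans (_ : e / 2 < e); last by rewrite ltr_pdivrMr // ltr_pMr // ltr1n.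
have -> : arc_sum a b f phi k.+1 - arc_sum a b f phi k =
  (arc_sum a b f phi k.+1 + P1) - (arc_sum a b f phi k + P2) - (P1 - P2) by ring.
by apply: (absvalB_le hv) => //; apply: (absvalB_le hv).
Qed.
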